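(* Let $\{X_k\}\subset\mathbb{R}^{r\times r_+}$ be a sequence such that $\{f(X_k)\}$ is descending (i.e. $f(X_{k+1})\le f(X_k)$ for all $k$) and $\lim_{k\to\infty}\nabla f(X_k)=0$. If there is a $k$ with $f(X_k)<f_{\min}$, then $\lim_{k\to\infty}f(X_k)=0$.
   Context: $A\in\mathbb{R}^{n\times n}$ is a completely positive matrix, i.e. $A=BB^T$ for some entrywise nonnegative matrix $B$; $r=\mathrm{rank}(A)$; the cp-rank $r_{cp}(A)$ is the smallest possible number of columns of such a $B$. $A=WW^T$ is a factorization with $W\in\mathbb{R}^{n\times r}$ of full column rank, $r_+\ge r_{cp}(A)$ is an integer, and $\lambda>0$. For a real matrix $Z$, $Z_-=\min\{Z,0\}$ (entrywise) denotes its negative part; $\|\cdot\|_F$ is the Frobenius norm. The function $f:\mathbb{R}^{r\times r_+}\to\mathbb{R}$ is $$f(X)=\tfrac14\|XX^T-I_r\|_F^2+\tfrac{\lambda}{2}\|(WX)_-\|_F^2 .$$ It is continuously differentiable with $\nabla f(X)=(XX^T-I_r)X+\lambda W^T(WX)_-$. A stationary point of $f$ is an $X$ with $\nabla f(X)=0$, and a critical value of $f$ is the value of $f$ at a stationary point. The function $f$ has only finitely many critical values, and $f_{\min}$ denotes the smallest nonzero critical value of $f$. *)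

(* Defs.v *)
From HB Require Import structures.
From mathcomp Require Import all_boot all_order all_algebra.
From mathcomp Require Import all_classical all_reals all_analysis.

Set Implicit Arguments.
Unset Strict Implicit.
Unset Printing Implicit Defensive.

Import Order.TTheory GRing.Theory Num.Theory.
Import numFieldNormedType.Exports.

Local Open Scope classical_set_scope.
Local Open Scope ring_scope.

Definition cp_factorizable (R : realType) (n : nat) (A : 'M[R]_n) (m : nat) :
    Prop :=
  exists B : 'M[R]_(n, m), (forall i j, 0 <= B i j) /\ A = B *m B^T.

Definition completely_positive (R : realType) (n : nat) (A : 'M[R]_n) : Prop :=
  exists m : nat, cp_factorizable A m.

Lemma completely_positive_asbool (R : realType) (n : nat) (A : 'M[R]_n) :
  completely_positive A -> exists m, `[< cp_factorizable A m >].
Proof. by move=> [m Am]; exists m; apply/asboolP. Qed.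

Definition cp_rank (R : realType) (n : nat) (A : 'M[R]_n)
    (hA : completely_positive A) : nat :=
  ex_minn (completely_positive_asbool hA).

(* The norm that the library puts on matrices is the max norm. *)
Definition frobenius_norm (R : realType) (m n : nat) (M : 'M[R]_(m, n)) : R :=
  Num.sqrt (\sum_(i < m) \sum_(j < n) M i j ^+ 2).

Definition neg_part_mx (R : realType) (m n : nat) (Z : 'M[R]_(m, n)) :
    'M[R]_(m, n) :=
  map_mx (fun z => Num.min z 0) Z.

(* The gradient for the inner product \tr (X^T *m Y): the matrix of the partial
   derivatives with respect to the entries. *)
Definition mx_gradient (R : realType) (m n : nat) (F : 'M[R]_(m, n) -> R)
    (X : 'M[R]_(m, n)) : 'M[R]_(m, n) :=
  \matrix_(i < m, j < n) derive F X (delta_mx i j).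

Definition stationary_point (R : realType) (m n : nat) (F : 'M[R]_(m, n) -> R)
    (X : 'M[R]_(m, n)) : Prop :=
  mx_gradient F X = 0.

Definition critical_values (R : realType) (m n : nat)
    (F : 'M[R]_(m, n) -> R) : set R :=
  [set F X | X in [set X | stationary_point F X]].

Definition smallest_nonzero_critical_value (R : realType) (m n : nat)
    (F : 'M[R]_(m, n) -> R) (v : R) : Prop :=
  [/\ critical_values F v, v != 0
    & forall w, critical_values F w -> w != 0 -> v <= w].

Definition cp_objective (R : realType) (n r rp : nat) (W : 'M[R]_(n, r))
    (lambda : R) (X : 'M[R]_(r, rp)) : R :=
  4^-1 * frobenius_norm (X *m X^T - 1%:M) ^+ 2
  + lambda / 2 * frobenius_norm (neg_part_mx (W *m X)) ^+ 2.

(* Main.v *)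
Require Import Defs.
From HB Require Import structures.
From mathcomp Require Import all_boot all_order all_algebra.
From mathcomp Require Import all_classical all_reals all_analysis.
From mathcomp Require Import ring lra.

Import Order.TTheory GRing.Theory Num.Theory.
Import numFieldNormedType.Exports.

Local Open Scope classical_set_scope.
Local Open Scope ring_scope.

(** The values f (X_k) decrease and are nonnegative, so they converge to some
    l >= 0, and l < fmin because one of them is below fmin.  It is enough to see
    that l is a critical value: a nonzero one would be at least fmin.

    That l is critical is a compactness argument ([critical_value_limit]).  The
    quartic term of f bounds every entry of X by a function of f (X)
    ([entry_le_cp_objective]), so all the X_k lie in a compact box and have a
    cluster point Z.  Continuity of the gradient gives grad f (Z) = 0, and
    continuity of f gives f (Z) = l.

    Continuity of the gradient needs no formula for it.  The objective is
    assembled from matrix entries by sums, products and the scalar map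
    z |-> min (z, 0) ^ 2, and having continuous directional derivatives ([C1])
    is preserved by each of these operations.  The last one is the only
    non-algebraic step: min (z, 0) has a kink at 0, but its square has there a
    first-order expansion with quadratic error ([sqr_neg_part_taylor]). *)

Set Implicit Arguments.
Unset Strict Implicit.
Unset Printing Implicit Defensive.

(** * Topology of matrices *)

Lemma cvg_mx_coord (R : realType) (m n : nat) (T : Type) (F : set_system T)
    (f : T -> 'M[R]_(m, n)) (M : 'M[R]_(m, n)) :
  Filter F -> (forall i j, f x i j @[x --> F] --> M i j) ->
  f x @[x --> F] --> M.
Proof.
move=> FF fM; apply/cvg_ballP => e e0.
have : \forall x \near F, forall i j, ball (M i j) e (f x i j).
  apply: filter_forall => i; apply: filter_forall => j.
  exact: (cvg_ball (fM i j)).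
by apply: filterS => x Hx; split.
Qed.

Lemma compact_mx_box (R : realType) (m n : nat) (b : R) :
  compact [set M : 'M[R]_(m, n) | forall i j, `|M i j| <= b].
Proof.
have cv : compact
    [set v : 'rV[R]_(m * n) | forall k, `[- b, b]%classic (v ord0 k)].
  by apply: (@rV_compact R _ (fun=> `[- b, b]%classic)) => k;
     exact: segment_compact.
have vec_mx_cont : continuous (@vec_mx R m n).
  move=> v; apply: (cvg_mx_coord (nbhs_filter v)) => i j.
  under eq_cvg do rewrite mxE.
  rewrite mxE; exact: coord_continuous.
rewrite (_ : mkset _ = @vec_mx R m n @`
    [set v : 'rV[R]_(m * n) | forall k, `[- b, b]%classic (v ord0 k)]).
  by apply: continuous_compact => //; exact: continuous_subspaceT.
apply/seteqP; split => [M Mb | _ [v vb <-] i j].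
  exists (mxvec M); last exact: mxvecK.
  move=> k; case/mxvec_indexP: k => i j.
  by rewrite mxvecE /= in_itv /= -ler_norml.
by rewrite mxE ler_norml; have := vb (mxvec_index i j); rewrite /= in_itv.
Qed.

(** * Functions with continuous directional derivatives *)

(** Gateaux derivatives suffice, since the gradient is a matrix of directional
    derivatives.  Continuity is required separately: directional derivatives at
    a point do not imply continuity there, and the product and chain rules for
    the derivative function use it. *)
Definition C1 (R : realType) (V : normedModType R) (F : V -> R) : Prop :=
  continuous F /\
  forall v, exists2 dF : V -> R, continuous dF
    & forall x, is_derive x v (F : V -> R^o) (dF x).

(** The bound says that z |-> min (z, 0) ^ 2 has derivative 2 min (a, 0) at
    every a, including the kink a = 0, with one error term for all signs of a
    and b. *)
Lemma sqr_neg_part_taylor (R : realType) (a b : R) :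
  `|Num.min b 0 ^+ 2 - Num.min a 0 ^+ 2 - (b - a) * (2 * Num.min a 0)|
    <= (b - a) ^+ 2.
Proof.
have ab := sqr_ge0 (b - a); have a2 := sqr_ge0 a; have b2 := sqr_ge0 b.
rewrite ler_norml; have [a0|a0] := leP a 0; have [b0|b0] := leP b 0.
- by apply/andP; split; nra.
- by have := mulr_le0_ge0 a0 (ltW b0) => ab0; apply/andP; split; nra.
- by have := mulr_ge0_le0 (ltW a0) b0 => ab0; apply/andP; split; nra.
- by apply/andP; split; nra.
Qed.

Section C1_closure.
Variables (R : realType) (V : normedModType R).
Implicit Types (F G : V -> R).

Lemma C1_cst (a : R) : C1 (fun=> a : R) (V := V).
Proof.
split; first by move=> x; exact: cvg_cst.
move=> v; exists (fun=> 0); first by move=> x; exact: cvg_cst.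
by move=> x; exact: is_derive_cst.
Qed.

Lemma C1D F G : C1 F -> C1 G -> C1 (fun x => F x + G x).
Proof.
move=> [cF dF] [cG dG]; split.
  by move=> x; apply: cvgD; [exact: cF|exact: cG].
move=> v; have [dFv cdF hF] := dF v; have [dGv cdG hG] := dG v.
exists (fun x => dFv x + dGv x).
  by move=> x; apply: cvgD; [exact: cdF|exact: cdG].
by move=> x; apply: is_deriveD.
Qed.

Lemma C1M F G : C1 F -> C1 G -> C1 (fun x => F x * G x).
Proof.
move=> [cF dF] [cG dG]; split.
  by move=> x; apply: cvgM; [exact: cF|exact: cG].
move=> v; have [dFv cdF hF] := dF v; have [dGv cdG hG] := dG v.
exists (fun x => F x * dGv x + G x * dFv x).
  move=> x; apply: cvgD; apply: cvgM;
    [exact: cF|exact: cdG|exact: cG|exact: cdF].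
by move=> x; apply: is_deriveM.
Qed.

Lemma C1_sum (I : Type) (s : seq I) (F : I -> V -> R) :
  (forall i, C1 (F i)) -> C1 (fun x => \sum_(i <- s) F i x).
Proof.
move=> CF; elim: s => [|i s IH].
  by under eq_fun do rewrite big_nil; exact: C1_cst.
by under eq_fun do rewrite big_cons; exact: C1D.
Qed.

(** A chain rule proved on difference quotients: the error of the first-order
    expansion is at most the square of the increment of F, which, divided by h,
    tends to (derivative of F) * 0. *)
Lemma C1_sqr_neg_part F : C1 F -> C1 (fun x => Num.min (F x) 0 ^+ 2).
Proof.
move=> [cF dF].
have cN : continuous (fun x => Num.min (F x) 0).
  by move=> x; apply: continuous_min => //; [exact: cF|exact: cvg_cst].
split; first by move=> x; exact: (cvgM (cN x) (cN x)).
move=> v; have [dFv cdF hF] := dF v.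
exists (fun x => dFv x * (2 * Num.min (F x) 0)).
  move=> x; apply: cvgM; first exact: cdF.
  by apply: cvgM; [exact: cvg_cst|exact: cN].
move=> x.
pose s h := F (h *: v + x) - F x.
have cvx : h *: v + x @[h --> (0 : R)^'] --> x.
  have : h *: v + x @[h --> (0 : R)] --> (0 : R) *: v + x.
    by apply: cvgD; [apply: cvgZr_tmp; exact: cvg_id|exact: cvg_cst].
  by rewrite scale0r add0r; exact: cvg_within_filter.
have cvF : F (h *: v + x) @[h --> (0 : R)^'] --> F x.
  exact: (continuous_cvg _ (cF x) cvx).
have cvs : s h @[h --> (0 : R)^'] --> (0 : R).
  have : s h @[h --> (0 : R)^'] --> F x - F x.
    by apply: cvgB => //; exact: cvg_cst.
  by rewrite subrr.
have cvq : h^-1 * s h @[h --> 0^'] --> dFv x.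
  have [dx <-] := hF x; exact: dx.
pose N y := Num.min (F y) 0 ^+ 2.
pose e h := h^-1 * (N (h *: v + x) - N x - s h * (2 * Num.min (F x) 0)).
have cve : e h @[h --> 0^'] --> (0 : R).
  apply/norm_cvg0P.
  apply: (@squeeze_cvgr _ _ _ _ (fun=> 0) (fun h => `|h^-1 * s h * s h|)).
  - apply: nearW => h; rewrite normr_ge0 /= -mulrA !(normrM h^-1).
    apply: ler_wpM2l => //; rewrite -expr2 [leRHS]ger0_norm ?sqr_ge0//.
    exact: sqr_neg_part_taylor.
  - exact: cvg_cst.
  - have : h^-1 * s h * s h @[h --> (0 : R)^'] --> dFv x * 0 by exact: cvgM.
    by rewrite mulr0 => /cvg_norm; rewrite normr0.
have cvN : h^-1 *: ((N \o shift x) (h *: v) - N x) @[h --> 0^']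
    --> (dFv x * (2 * Num.min (F x) 0) : R^o).
  have -> : (fun h => h^-1 *: ((N \o shift x) (h *: v) - N x)) =
      (fun h => e h + h^-1 * s h * (2 * Num.min (F x) 0)).
    by apply/funext => h; rewrite /e /s /= -[_ *: _]/(_ * _); ring.
  rewrite -[X in _ --> X](add0r (dFv x * (2 * Num.min (F x) 0) : R)).
  by apply: cvgD => //; apply: cvgM => //; exact: cvg_cst.
split; first by apply/cvg_ex; eexists; exact: cvN.
exact/cvg_lim.
Qed.

End C1_closure.

Lemma C1_coord (R : realType) (m n : nat) (i : 'I_m) (j : 'I_n) :
  C1 (fun M : 'M[R]_(m, n) => M i j).
Proof.
split; first exact: coord_continuous.
move=> v; exists (fun=> v i j); first exact: cst_continuous.
move=> M.
have cvq : h^-1 *: (((fun N : 'M[R]_(m, n) => N i j : R^o) \o shift M) (h *: v)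
    - M i j)
    @[h --> (0 : R)^'] --> (v i j : R^o).
  apply: cvg_near_cst; near=> h.
  have h0 : h != 0 by near: h; exact: nbhs_dnbhs_neq.
  by rewrite /= !mxE addrK -[_ *: _]/(_ * _) mulrA mulVf// mul1r.
by split; [apply/cvg_ex; eexists; exact: cvq|exact/cvg_lim].
Unshelve. all: by end_near. Qed.

(** The hypothesis bears on the squared entries because the entries of a
    negative part need not be differentiable themselves. *)
Lemma C1_frobenius_sqr (R : realType) (V : normedModType R) (m n : nat)
    (M : V -> 'M[R]_(m, n)) :
  (forall i j, C1 (fun x => M x i j ^+ 2)) ->
  C1 (fun x => frobenius_norm (M x) ^+ 2).
Proof.
move=> CM; under eq_fun => x.
  rewrite /frobenius_norm sqr_sqrtr; last first.
    by apply: sumr_ge0 => i _; apply: sumr_ge0 => j _; exact: sqr_ge0.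
  over.
by apply: C1_sum => i; exact: C1_sum.
Qed.

Lemma C1_mulmx_coord (R : realType) (n r p : nat)
    (W : 'M[R]_(n, r)) (i : 'I_n) (j : 'I_p) :
  C1 (fun X : 'M[R]_(r, p) => (W *m X) i j).
Proof.
under eq_fun do rewrite mxE.
by apply: C1_sum => k; apply: C1M; [exact: C1_cst|exact: C1_coord].
Qed.

Lemma continuous_mx_gradient (R : realType) (m n : nat)
    (F : 'M[R]_(m, n) -> R) : C1 F -> continuous (mx_gradient F).
Proof.
move=> [_ dF] X; apply: (cvg_mx_coord (nbhs_filter X)) => i j.
have [dFij cdF hF] := dF (delta_mx i j).
have E (Y : 'M[R]_(m, n)) : mx_gradient F Y i j = dFij Y.
  by rewrite mxE; have [_ ->] := hF Y.
by under eq_cvg do rewrite E; rewrite E; exact: cdF.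
Qed.

(** * Limits of values along sequences with vanishing gradient *)

(** A cluster point Z of the sequence is the limit of a filter finer than the
    sequence; the limits of F and of its gradient survive along that filter, so
    no subsequence has to be extracted. *)
Lemma critical_value_limit (R : realType) (m n : nat) (F : 'M[R]_(m, n) -> R)
    (X : nat -> 'M[R]_(m, n)) (b l : R) :
  C1 F -> (forall k i j, `|X k i j| <= b) ->
  mx_gradient F (X k) @[k --> \oo] --> (0 : 'M[R]_(m, n)) ->
  F (X k) @[k --> \oo] --> l ->
  critical_values F l.
Proof.
move=> CF Xb gX FX.
have boxX : \forall M \near X @ \oo, forall i j, `|(M : 'M[R]_(m, n)) i j| <= b.
  by apply: (@filterE _ \oo) => k; exact: Xb.
have [Z [_]] := compact_mx_box (fmap_proper_filter X _) boxX.
rewrite cluster_cvgE => -[G GF [GZ XG]].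
exists Z.
- have gZ : mx_gradient F @ G --> mx_gradient F Z.
    exact: (continuous_cvg _ (@continuous_mx_gradient _ _ _ _ CF Z) GZ).
  have g0 : mx_gradient F @ G --> (0 : 'M[R]_(m, n)).
    by apply: cvg_trans gX => B; exact: (XG (mx_gradient F @^-1` B)).
  exact: (cvg_unique (@norm_hausdorff _ _) gZ g0).
- have cF : continuous F by case: CF.
  have FZ : F @ G --> F Z by exact: (continuous_cvg _ (cF Z) GZ).
  have Fl : F @ G --> l by apply: cvg_trans FX => B; exact: (XG (F @^-1` B)).
  exact: (cvg_unique (@norm_hausdorff _ _) FZ Fl).
Qed.

(** * The objective function *)

Lemma C1_cp_objective (R : realType) (n r p : nat) (W : 'M[R]_(n, r))
    (lambda : R) : C1 (@cp_objective R n r p W lambda).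
Proof.
apply: C1D; apply: C1M; try exact: C1_cst.
- apply: C1_frobenius_sqr => i j; under eq_fun do rewrite !mxE expr2.
  have CG : C1 (fun X : 'M[R]_(r, p) =>
      \sum_k X i k * X^T k j - 1%:M i j).
    apply: C1D; last exact: C1_cst.
    apply: C1_sum => k; under eq_fun do rewrite mxE.
    by apply: C1M; exact: C1_coord.
  have := C1M CG CG; by under eq_fun do rewrite !mxE.
- apply: C1_frobenius_sqr => i j; under eq_fun do rewrite mxE.
  exact/C1_sqr_neg_part/C1_mulmx_coord.
Qed.

Lemma frobenius_norm_sqr_ge (R : realType) (m n : nat) (M : 'M[R]_(m, n))
    (i : 'I_m) (j : 'I_n) : M i j ^+ 2 <= frobenius_norm M ^+ 2.
Proof.
rewrite /frobenius_norm sqr_sqrtr; last first.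
  by apply: sumr_ge0 => k _; apply: sumr_ge0 => l _; exact: sqr_ge0.
rewrite (bigD1 i)//= (bigD1 j)//= -addrA lerDl addr_ge0//.
  by apply: sumr_ge0 => l _; exact: sqr_ge0.
by apply: sumr_ge0 => k _; apply: sumr_ge0 => l _; exact: sqr_ge0.
Qed.

Lemma cp_objective_ge0 (R : realType) (n r p : nat) (W : 'M[R]_(n, r))
    (lambda : R) (X : 'M[R]_(r, p)) :
  0 <= lambda -> 0 <= cp_objective W lambda X.
Proof.
move=> l0; apply: addr_ge0; apply: mulr_ge0;
  rewrite ?sqr_ge0 ?invr_ge0 ?ler0n//.
by rewrite divr_ge0.
Qed.

(** The i-th diagonal entry of X X^T is the squared length of row i of X, and
    the quartic term controls its distance to 1.  The constants come from using
    z <= 1 + z^2 twice instead of square roots. *)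
Lemma entry_le_cp_objective (R : realType) (n r p : nat) (W : 'M[R]_(n, r))
    (lambda : R) (X : 'M[R]_(r, p)) (i : 'I_r) (j : 'I_p) :
  0 <= lambda -> `|X i j| <= 3 + 4 * cp_objective W lambda X.
Proof.
move=> l0; set c := cp_objective W lambda X.
have c0 : 0 <= c by exact: cp_objective_ge0.
have Gii : (X *m X^T - 1%:M) i i ^+ 2 <= 4 * c.
  apply: le_trans (frobenius_norm_sqr_ge _ _ _) _.
  have : 0 <= lambda / 2 * frobenius_norm (neg_part_mx (W *m X)) ^+ 2.
    by rewrite mulr_ge0 ?sqr_ge0// divr_ge0.
  by rewrite /c /cp_objective; lra.
have Xij : X i j ^+ 2 <= (X *m X^T) i i.
  rewrite mxE (bigD1 j)//= mxE -expr2 lerDl; apply: sumr_ge0 => k _.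
  by rewrite mxE -expr2 sqr_ge0.
have Eii : (X *m X^T - 1%:M) i i = (X *m X^T) i i - 1.
  by rewrite [LHS]mxE [X in _ + X]mxE [X in _ - X]mxE eqxx.
rewrite {}Eii in Gii.
have le1D_sqr (z : R) : z <= 1 + z ^+ 2.
  by have := sqr_ge0 (z - 2^-1); nra.
have := le1D_sqr ((X *m X^T) i i - 1); have := le1D_sqr `|X i j|.
by rewrite real_normK ?num_real//; lra.
Qed.

Unset Implicit Arguments.

Theorem theorem2 (R : realType) (n r rp : nat) (A : 'M[R]_n)
    (W : 'M[R]_(n, r)) (lambda fmin : R) (X : nat -> 'M[R]_(r, rp))
    (hA : completely_positive A) (hr : r = \rank A)
    (hWA : A = W *m W^T) (hW : \rank W = r)
    (hrp : (cp_rank hA <= rp)%N) (hlambda : 0 < lambda)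
    (hfmin : smallest_nonzero_critical_value
               (@cp_objective R n r rp W lambda) fmin)
    (hdesc : forall k : nat,
       cp_objective W lambda (X k.+1) <= cp_objective W lambda (X k))
    (hgrad : mx_gradient (@cp_objective R n r rp W lambda) (X k)
               @[k --> \oo] --> (0 : 'M[R]_(r, rp)))
    (hlt : exists k : nat, cp_objective W lambda (X k) < fmin) :
  cp_objective W lambda (X k) @[k --> \oo] --> (0 : R).
Proof.
pose u k := cp_objective W lambda (X k).
have u_ge0 k : 0 <= u k by apply: cp_objective_ge0; exact: ltW.
have u_ni : nonincreasing_seq u by apply/nonincreasing_seqP.
have u_cvg : cvgn u.
  by apply: nonincreasing_is_cvgn => //; exists 0 => _ [k _ <-].
have u_lim := nonincreasing_cvgn_ge u_ni u_cvg.
have X_bnd k i j : `|X k i j| <= 3 + 4 * u 0%N.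
  apply: le_trans (entry_le_cp_objective W _ _ _ (ltW hlambda)) _.
  by rewrite lerD2l ler_wpM2l//; exact: u_ni.
have lim_crit : critical_values (@cp_objective R n r rp W lambda) (limn u).
  exact: (critical_value_limit (C1_cp_objective rp W lambda) X_bnd hgrad u_cvg).
have [_ _ fmin_le] := hfmin; have [k uk] := hlt.
have lim0 : limn u = 0.
  apply/eqP/negPn/negP => /(fmin_le _ lim_crit).
  by rewrite leNgt (le_lt_trans (u_lim k) uk).
by rewrite -lim0.
Qed.
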